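(* Let $T$ and $U$ be points of $\mathrm{PG}(1,E)$, with $T$ scattered. The following are equivalent: (i) there exists a collineation $\kappa\in\mathrm{P\Gamma L}_2(q^t)$ of $\mathrm{PG}(1,q^t)$ whose accompanying automorphism lies in $\mathrm{Gal}(\mathbb{F}_{q^t}/\mathbb{F}_q)$ such that $\mathcal{B}(T)^\kappa=\mathcal{B}(U)$; (ii) $L_T$ and $L_U$ are projectively equivalent in $\mathrm{PG}(1,E)$, i.e. there is a projectivity $\pi$ of $\mathrm{PG}(1,E)$ with $(L_T)^\pi=L_U$.
   Context: Let $q$ be a prime power, $t\ge 2$, and $E=\mathrm{End}_{\mathbb{F}_q}(\mathbb{F}_{q^t})$, the ring of $\mathbb{F}_q$-linear maps $\mathbb{F}_{q^t}\to\mathbb{F}_{q^t}$, maps written on the right ($x\mapsto x^\alpha$) and composed left to right; $E^*$ is its unit group. For $a\in\mathbb{F}_{q^t}$ let $\rho_a\in E$ be $x\mapsto ax$. $E^2$ is a left $E$-module of row vectors with $\mathrm{GL}_2(E)$ acting from the right. A pair $(\alpha,\beta)\in E^2$ is admissible if it is the first row of a matrix in $\mathrm{GL}_2(E)$. The projective line $\mathrm{PG}(1,E)$ is the set of cyclic submodules $E(\alpha,\beta)$ with $(\alpha,\beta)$ admissible (points); $E(\alpha,\beta)=E(\alpha',\beta')$ iff $(\alpha',\beta')=(\gamma\alpha,\gamma\beta)$ for some $\gamma\in E^*$. Two points $E(\alpha,\beta),E(\gamma,\delta)$ are distant if the matrix with rows $(\alpha,\beta)$, $(\gamma,\delta)$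 lies in $\mathrm{GL}_2(E)$, non-distant otherwise. A projectivity of $\mathrm{PG}(1,E)$ is a map $E(\alpha,\beta)\mapsto E((\alpha,\beta)M)$ for a fixed $M\in\mathrm{GL}_2(E)$. $\mathrm{PG}(1,F)$ denotes $\{E(\rho_a,\rho_b): (a,b)\in\mathbb{F}_{q^t}^2\setminus\{(0,0)\}\}$, and $\iota:\mathrm{PG}(1,q^t)\to\mathrm{PG}(1,E)$, $\langle(a,b)\rangle_{q^t}\mapsto E(\rho_a,\rho_b)$. For a point $T$, $L_T$ is the set of points of $\mathrm{PG}(1,F)$ non-distant to $T$, and $\mathcal{B}(T)=\iota^{-1}(L_T)\subseteq\mathrm{PG}(1,q^t)$; equivalently, for $T=E(\alpha,\beta)$, $\mathcal{B}(T)=\{\langle(u^\alpha,u^\beta)\rangle_{q^t}: u\in\mathbb{F}_{q^t}^*\}$ (an $\mathbb{F}_q$-linear set of rank $t$). $T$ is scattered if $|L_T|=(q^t-1)/(q-1)$. A collineation in $\mathrm{P\Gamma L}_2(q^t)$ has the form $\langle(a,b)\rangle_{q^t}\mapsto\langle(a^\eta,b^\eta)M\rangle_{q^t}$ with $M\in\mathrm{GL}_2(q^t)$ and $\eta$ its accompanying field automorphism. *)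

(* Defs.v *)
From HB Require Import structures.
From mathcomp Require Import all_boot all_algebra all_field.
From mathcomp Require Import classical_sets cardinality.

Set Implicit Arguments.
Unset Strict Implicit.
Unset Printing Implicit Defensive.

Import GRing.Theory.
(* The ring structure on 'End(L): f * g is "f, then g" (lfun_mulE), i.e. maps
   written on the right and composed from left to right. *)
Export FalgLfun.

Local Open Scope ring_scope.
Local Open Scope classical_set_scope.

Section ProjectiveLineOverRing.
Variable E : nzRingType.

(* unitmx is only available over commutative rings. *)
Definition GL2 (M : 'M[E]_2) : Prop :=
  exists N : 'M[E]_2, M *m N = 1%:M /\ N *m M = 1%:M.

Definition admissible (v : 'rV[E]_2) : Prop :=
  exists2 M : 'M[E]_2, GL2 M & row 0 M = v.

Definition cyclic_submod (v : 'rV[E]_2) : set 'rV[E]_2 :=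
  [set gamma *: v | gamma in [set: E]].

Definition PG1E : set (set 'rV[E]_2) :=
  [set cyclic_submod v | v in admissible].

(* Invertibility of the matrix does not depend on the representatives. *)
Definition distant (X Y : set 'rV[E]_2) : Prop :=
  exists v w : 'rV[E]_2,
    [/\ X = cyclic_submod v, Y = cyclic_submod w & GL2 (col_mx v w)].

(* The values of pi outside PG1E are irrelevant. *)
Definition projectivity (pi : set 'rV[E]_2 -> set 'rV[E]_2) : Prop :=
  exists2 M : 'M[E]_2, GL2 M &
    forall v, admissible v -> pi (cyclic_submod v) = cyclic_submod (v *m M).

End ProjectiveLineOverRing.

Section LinearSets.
Variables (F : finFieldType) (L : fieldExtType F).
Local Notation E := 'End(L).

(* amull a is x |-> a * x. *)
Definition rho_row (v : 'rV[L]_2) : 'rV[E]_2 := map_mx (@amull F L) v.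

Definition PG1F : set (set 'rV[E]_2) :=
  [set cyclic_submod (rho_row v) | v in [set v : 'rV[L]_2 | v != 0]].

Definition PG1 : set {vspace 'rV[L]_2} := [set X | \dim X = 1%N].

Definition iotaPG (X : {vspace 'rV[L]_2}) : set 'rV[E]_2 :=
  cyclic_submod (rho_row (vpick X)).

Lemma iotaPG_vline (v : 'rV[L]_2) : v != 0 ->
  iotaPG <[v]>%VS = cyclic_submod (rho_row v).
Proof.
move=> v0; have rhoZ (c : L) w : rho_row (c *: w) = amull c *: rho_row w.
  apply/rowP => j; rewrite !mxE; apply/lfunP => x.
  by rewrite lfun_mulE !lfunE /= mulrCA mulrA.
have sub (c : L) (w : 'rV[L]_2) :
    cyclic_submod (rho_row (c *: w)) `<=` cyclic_submod (rho_row w).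
  by move=> _ [g _ <-]; exists (g * amull c); rewrite // rhoZ scalerA.
have [c Dc] := vlineP _ _ (memv_pick <[v]>%VS).
have c0 : c != 0.
  apply: contraNneq v0 => c0; move: Dc; rewrite c0 scale0r => /eqP.
  by rewrite vpick0 -memv0 => /eqP <-; apply: memv_line.
rewrite /iotaPG Dc; apply/seteqP; split; first exact: sub.
by rewrite -{1}[v](scalerK c0); rewrite scalerA mulVf // scale1r
   -{1}[v](scalerK c0); apply: sub.
Qed.

Definition Lset (T : set 'rV[E]_2) : set (set 'rV[E]_2) :=
  [set X | PG1F X /\ ~ distant X T].

Definition Bset (T : set 'rV[E]_2) : set {vspace 'rV[L]_2} :=
  PG1 `&` iotaPG @^-1` Lset T.

(* #|F| = q and \dim {:L} = t; the division is exact. *)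
Definition scattered (T : set 'rV[E]_2) : Prop :=
  (Lset T #= `I_((#|F| ^ \dim {:L} - 1) %/ (#|F| - 1)))%card.

(* kappa is the collineation <(a, b)> |-> <(a^eta, b^eta) M> for some
   invertible M; eta is meant to be a field automorphism of L (eta in
   Gal(L / F) is expressed by kAut 1 {:L} eta, since 'Gal requires a declared
   splittingFieldType). The values of kappa outside PG1 are irrelevant. *)
Definition collineation_with (eta : L -> L)
    (kappa : {vspace 'rV[L]_2} -> {vspace 'rV[L]_2}) : Prop :=
  exists2 M : 'M[L]_2, M \in unitmx &
    forall v : 'rV[L]_2, v != 0 -> kappa <[v]>%VS = <[map_mx eta v *m M]>%VS.

End LinearSets.

(* Main.v *)
(* A semilinear map of L^2 whose automorphism eta fixes F is F-linear, hence an
   element of GL_2(E), and it permutes PG(1,F).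
   Conversely, suppose that a projectivity maps L_T to L_U. As T is scattered,
   L_T has three points, and composing with elements of GL_2(L) on both sides we
   may assume that E(1,0), E(0,1) and E(1,1) are in L_T and are fixed. The
   projectivity is then given by a scalar matrix mu and takes E(1,rho_b) to
   E(1, mu^-1 rho_b mu). The b for which mu^-1 rho_b mu is again of the form
   rho_b' make up a subfield K of L, and b |-> b' is an F-embedding of K in L.
   It extends to some eta in Gal(L/F), and <(a,b)> |-> <(a^eta,b^eta)> agrees
   with the projectivity on L_T. *)
From HB Require Import structures.
Require Import Defs.
From mathcomp Require Import all_boot all_algebra all_field.
From mathcomp Require Import classical_sets cardinality.

Set Implicit Arguments.
Unset Strict Implicit.
Unset Printing Implicit Defensive.

Import GRing.Theory.

Local Open Scope ring_scope.
Local Open Scope classical_set_scope.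

(** * Matrices acting on cyclic submodules *)

Section CyclicSubmodules.
Variable E : nzRingType.
Implicit Types (v w : 'rV[E]_2) (M P Q : 'M[E]_2) (X : set 'rV[E]_2).

Lemma mem_cyclic_submod v : cyclic_submod v v.
Proof. by exists 1; rewrite ?scale1r. Qed.

(** Acting on arbitrary sets of rows makes a projectivity a total function, with no choice of
    generators. *)
Definition mx_image X M : set 'rV[E]_2 := (mulmx^~ M) @` X.

Lemma mx_image_cyclic v M : mx_image (cyclic_submod v) M = cyclic_submod (v *m M).
Proof.
apply/seteqP; split => [_ [_ [g _ <-] <-] | _ [g _ <-]].
  by exists g; rewrite // scalemxAl.
by exists (g *: v); [exists g | rewrite scalemxAl].
Qed.

Lemma mx_imageM X M P : mx_image X (M *m P) = mx_image (mx_image X M) P.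
Proof.
by rewrite /mx_image image_comp; apply: eq_imagel => v _ /=; rewrite mulmxA.
Qed.

Lemma mx_image1 X : mx_image X 1%:M = X.
Proof. by rewrite -[RHS]image_id; apply: eq_imagel => v _; rewrite mulmx1. Qed.

Lemma mx_image_inj M : GL2 M -> injective (mx_image^~ M).
Proof.
move=> [N [MN _]] X Y /= /(congr1 (mx_image^~ N)).
by rewrite -!mx_imageM MN !mx_image1.
Qed.

Lemma cyclic_submodZ (g h : E) v : h * g = 1 ->
  cyclic_submod (g *: v) = cyclic_submod v.
Proof.
move=> hg; apply/seteqP; split=> _ [k _ <-].
  by exists (k * g); rewrite ?scalerA.
by exists (k * h); rewrite // scalerA -mulrA hg mulr1.
Qed.

Lemma mul_shift_r (a m g b c : E) : a * m = g * b -> b * c = 1 -> g = a * m * c.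
Proof. by move=> -> bc; rewrite -mulrA bc mulr1. Qed.

(* Eliminates g; with a = rho_(x0), b = rho_(y0), c = rho_(x1), d = rho_(y1), it
   says that conjugation by m takes x1 / x0 to y1 / y0. *)
Lemma conj_ratio (m g a a' b b' c d : E) : a' * a = 1 -> b * b' = 1 ->
  a * m = g * b -> c * m = g * d -> b' * d = d * b' ->
  a' * c * m = m * (d * b').
Proof.
move=> aV bV am cm bd; rewrite -mulrA cm (mul_shift_r am bV) !mulrA aV mul1r.
by rewrite -!mulrA bd.
Qed.

Lemma mx_image_comp M P : GL2 M -> GL2 P ->
  exists2 Q, GL2 Q & forall X, mx_image X Q = mx_image (mx_image X M) P.
Proof.
move=> [N [MN NM]] [Q [PQ QP]]; exists (M *m P); last by move=> X; exact: mx_imageM.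
exists (Q *m N); split.
  by rewrite mulmxA -(mulmxA M) PQ mulmx1.
by rewrite mulmxA -(mulmxA Q) NM mulmx1.
Qed.

Lemma GL2_scalar (g h : E) : g * h = 1 -> h * g = 1 -> GL2 (g%:M : 'M[E]_2).
Proof. by move=> gh hg; exists h%:M; rewrite -!scalar_mxM gh hg. Qed.

Lemma projectivity_mx_image M : GL2 M -> projectivity (mx_image^~ M).
Proof. by move=> GM; exists M => // v _; apply: mx_image_cyclic. Qed.

End CyclicSubmodules.

(** * Multiplications by field elements and the points of PG(1,F) *)

Section LinearSets.
Variables (F : finFieldType) (L : fieldExtType F).
Local Notation E := 'End(L).
Local Notation rho_mx := (map_mx (@amulr F L)).
Local Notation point v := (cyclic_submod (rho_row v)).
Implicit Types (u v w x y : 'rV[L]_2) (A B M : 'M[L]_2) (P Q : 'M[E]_2).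

(* amull reverses products, as 'End(L) composes from left to right; amulr is the
   ring morphism. *)
Lemma amullE : @amull F L =1 @amulr F L.
Proof. by move=> a; apply/lfunP => x; rewrite !lfunE /= mulrC. Qed.

Lemma rho_rowE v : rho_row v = rho_mx v.
Proof. by apply: eq_map_mx; apply: amullE. Qed.

Lemma rho_rowM v M : rho_row (v *m M) = rho_row v *m rho_mx M.
Proof. by rewrite !rho_rowE map_mxM. Qed.

Lemma mx_image_rho v M : mx_image (point v) (rho_mx M) = point (v *m M).
Proof. by rewrite mx_image_cyclic rho_rowM. Qed.

Lemma rho_rowZ c v : rho_row (c *: v) = amulr c *: rho_row v.
Proof. by rewrite !rho_rowE map_mxZ. Qed.

Lemma amulrV c : c != 0 -> amulr c^-1 * amulr c = 1 :> E.
Proof. by move=> c0; rewrite -rmorphM mulVf // rmorph1. Qed.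

Lemma amulrVr c : c != 0 -> amulr c * amulr c^-1 = 1 :> E.
Proof. by move=> c0; rewrite -rmorphM divff // rmorph1. Qed.

Lemma amulrM c d : amulr (c * d) = amulr c * amulr d :> E.
Proof. exact: rmorphM. Qed.

Lemma pointZ c v : c != 0 -> point (c *: v) = point v.
Proof. by move=> c0; rewrite rho_rowZ; apply: cyclic_submodZ (amulrV c0). Qed.

Lemma GL2_rho M : M \in unitmx -> GL2 (rho_mx M).
Proof.
by move=> uM; exists (rho_mx (invmx M));
   rewrite -!map_mxM mulmxV // mulVmx // map_mx1.
Qed.

(** A priori the generators differ by some [g] in E; evaluating at 1 turns [g] into the scalar
    [g 1]. *)
Lemma point_eqP v w : w != 0 -> point v = point w ->
  exists2 c, c != 0 & w = c *: v.
Proof.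
move=> w0 vw; have : point v (rho_row w) by rewrite vw; apply: mem_cyclic_submod.
case=> g _ gw; have wE : w = g 1 *: v.
  apply/rowP=> j; have /rowP/(_ j) := gw; rewrite !mxE => /lfunP/(_ 1).
  by rewrite lfun_mulE !lfunE /= mulr1 => <-; rewrite mulrC.
exists (g 1); last exact: wE.
by move: w0; rewrite wE scaler_eq0 negb_or => /andP[].
Qed.

(** * Frames of PG(1,F) and projectivities that fix one *)

Definition rows2 u v : 'M[L]_2 := \matrix_(i < 2) (if i == 0 then u else v).

Lemma mul_rows2 x u v : x *m rows2 u v = x 0 0 *: u + x 0 1 *: v.
Proof.
by rewrite mulmx_sum_row !big_ord_recl big_ord0 addr0 !rowK /=;
   congr (_ + x _ _ *: _); apply/val_inj.
Qed.

Lemma unitmx_rows2 u v : u != 0 -> v != 0 -> point u <> point v ->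
  rows2 u v \in unitmx.
Proof.
move=> u0 v0 uv; rewrite -row_free_unit; apply: inj_row_free => x.
rewrite mul_rows2 => xuv.
have x1 : x 0 1 = 0.
  have [//|x1] := eqVneq (x 0 1) 0; case: uv.
  have vE : v = (- ((x 0 1)^-1 * x 0 0)) *: u.
    apply: (scalerI x1); rewrite scalerA mulrN mulrA divff // mul1r scaleNr.
    by apply/eqP; rewrite -addr_eq0 addrC xuv.
  rewrite [in RHS]vE pointZ //.
  by apply: contraNneq v0 => c0; rewrite vE c0 scale0r.
have x0 : x 0 0 = 0.
  move/eqP: xuv; rewrite x1 scale0r addr0 scaler_eq0 (negPf u0) orbF.
  by move/eqP.
by apply/rowP=> j; rewrite mxE; case: j => [[|[|//]] lt_j];
   [rewrite -x0 | rewrite -x1]; congr (x _ _); apply/val_inj.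
Qed.

(** A unit vector serves as second row: the first one if [v 0 0 = 0], the second one otherwise. *)
Lemma rho_admissible v : v != 0 -> admissible (rho_row v).
Proof.
move=> v0; have [w w0 vw] : exists2 w, w != 0 & point v <> point w.
  have d0 j : delta_mx 0 j != 0 :> 'rV[L]_2.
    by apply/eqP=> /rowP/(_ j)/eqP; rewrite !mxE !eqxx oner_eq0.
  have [v00|v00] := eqVneq (v 0 0) 0.
    exists (delta_mx 0 0); first exact: d0.
    move/(point_eqP (d0 _)) => [c _ /rowP/(_ 0)/eqP].
    by rewrite !mxE v00 mulr0 !eqxx oner_eq0.
  exists (delta_mx 0 1); first exact: d0.
    move/(point_eqP (d0 _)) => [c c0 /rowP/(_ 0)/eqP].
  by rewrite !mxE /= eq_sym mulf_eq0 (negPf c0) (negPf v00).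
exists (rho_mx (rows2 v w)); first exact/GL2_rho/unitmx_rows2.
by rewrite -map_row rowK /= rho_rowE.
Qed.

Definition e0 : 'rV[L]_2 := delta_mx 0 0.
Definition e1 : 'rV[L]_2 := delta_mx 0 1.

(** The rows of [A] are multiples of [u] and [v] chosen so that their sum is [w]; the coefficients
    do not vanish because the points are distinct. *)
Lemma frame_transitivity u v w :
    [/\ u != 0, v != 0 & w != 0] ->
    [/\ point u <> point v, point u <> point w & point v <> point w] ->
  exists2 A, A \in unitmx &
    [/\ point (e0 *m A) = point u, point (e1 *m A) = point v
      & point ((e0 + e1) *m A) = point w].
Proof.
move=> [u0 v0 w0] [uv uw vw]; have uB := unitmx_rows2 u0 v0 uv.
have [x wE] : exists x, w = x 0 0 *: u + x 0 1 *: v.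
  by exists (w *m invmx (rows2 u v)); rewrite -mul_rows2 mulmxKV.
have x0 : x 0 0 != 0.
  apply: contra_notN vw => /eqP x0; move: w0; rewrite wE x0 scale0r add0r.
  by rewrite scaler_eq0 negb_or => /andP[x1 _]; apply/esym/pointZ.
have x1 : x 0 1 != 0.
  apply: contra_notN uw => /eqP x1; rewrite wE x1 scale0r addr0.
  exact/esym/pointZ.
exists (rows2 (x 0 0 *: u) (x 0 1 *: v)).
  apply: unitmx_rows2; first by rewrite scaler_eq0 negb_or x0.
    by rewrite scaler_eq0 negb_or x1.
  by have [-> ->] := (pointZ u x0, pointZ v x1).
rewrite !mul_rows2 !mxE /= !(scale0r, scale1r, addr0, add0r) -wE.
by split; [apply: pointZ | apply: pointZ |].
Qed.

(* b |-> mu (b * nu 1) is F-linear and takes b to b' as soon as conjugation by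
   mu takes rho_b to rho_b'; on the subfield of all such b it is multiplicative,
   hence it extends to an automorphism of L. *)
Lemma conj_amulr_AEnd (mu nu : E) : mu * nu = 1 -> nu * mu = 1 ->
  exists eta : 'AEnd(L),
    forall b b', amulr b * mu = mu * amulr b' -> eta b = b'.
Proof.
move=> munu numu; pose f : E := amull (nu 1) * mu.
(* Both sides are evaluated at [nu 1], which [mu] sends to 1. *)
have fE b b' : amulr b * mu = mu * amulr b' -> f b = b'.
  move/lfunP/(_ (nu 1)); rewrite !lfun_mulE !lfunE /= => ->.
  by rewrite -lfun_mulE numu lfunE /= mul1r.
(* [g] measures how far conjugation by [mu] is from taking rho_b to rho_(f b); it is linear, so its
   kernel is a subspace. *)
pose g b := amulr b * mu - mu * amulr (f b).
have g_lin : linear g.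
  move=> c a b; rewrite /g !linearP /= mulrDl mulrDr -scalerAl -scalerAr.
  by rewrite opprD scalerBr addrACA.
pose gM := GRing.isLinear.Build _ _ _ _ g g_lin.
pose gL : {linear L -> E} := HB.pack g gM.
pose K := lker (linfun gL).
have KP b : reflect (amulr b * mu = mu * amulr (f b)) (b \in K).
  have -> : (b \in K) = (g b == 0) by rewrite memv_ker lfunE.
  by rewrite subr_eq0; apply: eqP.
have K1 : 1 \in K.
  by apply/KP; rewrite (fE 1 1) rmorph1 mul1r mulr1.
have KM a b : a \in K -> b \in K ->
    amulr (a * b) * mu = mu * amulr (f a * f b).
  move=> /KP Ka /KP Kb; rewrite !rmorphM /= -mulrA Kb !mulrA Ka.
  by rewrite -!mulrA.
have K_aspace : is_aspace K.
  rewrite /is_aspace has_algid1 //; apply/prodvP => a b Ka Kb.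
  by apply/KP; rewrite (fE _ _ (KM _ _ Ka Kb)) KM.
pose KA := ASpace K_aspace.
have fhom : kHom 1 KA f.
  apply/kHomP_tmp; split=> [_ /vlineP[c ->] | a b Ka Kb].
    by rewrite linearZ /= (fE 1 1) // rmorph1 mul1r mulr1.
  by apply: fE; apply: KM.
(* A finite extension of a finite field is a splitting field, so the embedding [f] of the subfield
   [KA] extends to an automorphism. *)
have [eta eta_f] := @kHom_to_AEnd F (FinSplittingFieldType F L) _ KA f fhom.
exists eta => b b' bb'; rewrite -(fE _ _ bb'); apply/esym/eta_f/KP.
by rewrite (fE _ _ bb').
Qed.

(** Fixing E(1,0) and E(0,1) makes [Q] diagonal, and fixing E(1,1) makes its diagonal entries equal;
    [mu] is this entry and [nu] that of the inverse matrix. *)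
Lemma GL2_fix_frame Q : GL2 Q ->
    mx_image (point e0) Q = point e0 -> mx_image (point e1) Q = point e1 ->
    mx_image (point (e0 + e1)) Q = point (e0 + e1) ->
  exists mu nu : E, [/\ mu * nu = 1, nu * mu = 1 &
    forall x y, mx_image (point x) Q = point y ->
      exists g, forall k, amulr (x 0 k) * mu = g * amulr (y 0 k)].
Proof.
have lift01 : lift ord0 ord0 = 1 :> 'I_2 by apply/val_inj.
have ord2 (i : 'I_2) : i = 0 \/ i = 1.
  by case: i => [[|[|//]] i]; [left | right]; apply/val_inj.
have imQ x y : mx_image (point x) Q = point y -> exists g, forall k,
    amulr (x 0 0) * Q 0 k + amulr (x 0 1) * Q 1 k = g * amulr (y 0 k).
  have := mem_cyclic_submod (rho_row x *m Q).
  rewrite mx_image_cyclic => /[swap] -> -[g _ /rowP gE].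
  exists g => k; have := gE k; rewrite !rho_rowE !mxE => ->.
  by rewrite !big_ord_recl big_ord0 addr0 lift01 !mxE.
move=> [N [QN NQ]] /imQ[g0 g0E] /imQ[g1 g1E] /imQ[g gE].
have Q01 : Q 0 1 = 0.
  have:= g0E 1; rewrite !mxE /= rmorph1 !rmorph0.
  by rewrite mul1r mul0r addr0 mulr0.
have Q10 : Q 1 0 = 0.
  have:= g1E 0; rewrite !mxE /= rmorph1 !rmorph0.
  by rewrite mul1r mul0r add0r mulr0.
have Q11 : Q 1 1 = Q 0 0.
  have:= gE 1; have:= gE 0; rewrite Q01 Q10 !mxE /= !(addr0, add0r) !rmorph1.
  by rewrite !mul1r !(addr0, add0r) => -> ->.
exists (Q 0 0), (N 0 0); split.
- have /matrixP/(_ 0 0) := QN; rewrite !mxE !big_ord_recl big_ord0 addr0 /=.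
  by rewrite lift01 Q01 mul0r addr0.
- have /matrixP/(_ 0 0) := NQ; rewrite !mxE !big_ord_recl big_ord0 addr0 /=.
  by rewrite lift01 Q10 mulr0 addr0.
move=> x y /imQ[h hE]; exists h => k; rewrite -hE.
by case: (ord2 k) => ->; rewrite ?Q01 ?Q10 ?Q11 mulr0 ?addr0 ?add0r.
Qed.

(** For y_i nonzero, eliminating [g] shows that conjugation by [mu] takes x_k/x_i to y_k/y_i; hence
    so does [eta], and it maps [x] to a multiple of [y]. *)
Lemma point_AEnd (mu nu g : E) (eta : 'AEnd(L)) x y :
    mu * nu = 1 ->
    (forall b b', amulr b * mu = mu * amulr b' -> eta b = b') ->
    x != 0 -> y != 0 ->
    (forall k, amulr (x 0 k) * mu = g * amulr (y 0 k)) ->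
  point (map_mx eta x) = point y.
Proof.
move=> munu etaP x0 y0 gE.
have [i yi] : exists i, y 0 i != 0.
  by apply/existsP; apply: contraR y0; rewrite negb_exists => /forallP yk;
     apply/eqP/rowP=> k; rewrite mxE; apply/eqP/negPn/yk.
have gV : g = amulr (x 0 i) * mu * amulr (y 0 i)^-1.
  exact: mul_shift_r (gE i) (amulrVr yi).
(* If x_i were 0, then [g] would be 0 and, as [mu] has a right inverse, so would every x_k. *)
have xi : x 0 i != 0.
  apply: contraNneq x0 => xi; apply/eqP/rowP=> k; rewrite mxE.
  apply: (@amulr_inj F L); rewrite rmorph0 -[LHS]mulr1 -munu mulrA gE gV xi.
  by rewrite rmorph0 !mul0r.
have etaE k : eta (x 0 k) = eta (x 0 i) / y 0 i * y 0 k.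
  rewrite mulrAC -mulrA -(etaP ((x 0 i)^-1 * x 0 k) (y 0 k / y 0 i)).
    by rewrite -rmorphM mulVKf.
  rewrite !amulrM; apply: conj_ratio (amulrV xi) (amulrVr yi) (gE i) (gE k) _.
  by rewrite -!amulrM mulrC.
have -> : map_mx eta x = (eta (x 0 i) / y 0 i) *: y.
  by apply/rowP=> k; rewrite !mxE; exact: etaE.
apply: pointZ; apply: mulf_neq0; last by rewrite invr_eq0.
by rewrite fmorph_eq0.
Qed.

(* Frames move three of the points and their images to <e0>, <e1>, <e0 + e1>;
   P then becomes a scalar matrix mu, so that on the points of S it acts as
   conjugation of the rho_b by mu. *)
Lemma GL2_semilinear_on (S : set 'rV[L]_2) P :
    GL2 P ->
    (forall v, S v -> v != 0 /\
       exists2 w, w != 0 & mx_image (point v) P = point w) ->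
    (exists v1 v2 v3, [/\ S v1, S v2 & S v3] /\
       [/\ point v1 <> point v2, point v1 <> point v3 & point v2 <> point v3]) ->
  exists (eta : 'AEnd(L)) (M : 'M[L]_2), M \in unitmx /\
    forall v, S v -> mx_image (point v) P = point (map_mx eta v *m M).
Proof.
move=> GP SP [v1 [v2 [v3 [[/SP[v10 [w1 w10 vw1]] /SP[v20 [w2 w20 vw2]]
  /SP[v30 [w3 w30 vw3]]] [v12 v13 v23]]]]].
have w_neq v w v' w' : mx_image (point v) P = point w ->
    mx_image (point v') P = point w' -> point v <> point v' -> point w <> point w'.
  by move=> <- <- vv' /(mx_image_inj GP).
have [A uA [A1 A2 A3]] :=
  frame_transitivity (And3 v10 v20 v30) (And3 v12 v13 v23).
have [B uB [B1 B2 B3]] :=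
  frame_transitivity (And3 w10 w20 w30)
    (And3 (w_neq _ _ _ _ vw1 vw2 v12) (w_neq _ _ _ _ vw1 vw3 v13)
      (w_neq _ _ _ _ vw2 vw3 v23)).
have uB' : invmx B \in unitmx by rewrite unitmx_inv.
have [R GR RE] := mx_image_comp (GL2_rho uA) GP.
have [Q GQ QE] := mx_image_comp GR (GL2_rho uB').
have AQB x v w : point (x *m A) = point v -> mx_image (point v) P = point w ->
    mx_image (point x) Q = point (w *m invmx B).
  by move=> xv vw; rewrite QE RE (mx_image_rho x A) xv vw; exact: mx_image_rho.
have Bw x w : point (x *m B) = point w -> point (w *m invmx B) = point x.
  move=> xw; have := mx_image_rho (x *m B) (invmx B).
  by rewrite (mulmxK uB) xw => <-; apply/esym/mx_image_rho.
have [mu [nu [munu numu muE]]] := GL2_fix_frame GQ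
  (etrans (AQB _ _ _ A1 vw1) (Bw _ _ B1)) (etrans (AQB _ _ _ A2 vw2) (Bw _ _ B2))
  (etrans (AQB _ _ _ A3 vw3) (Bw _ _ B3)).
have [eta etaP] := conj_amulr_AEnd munu numu.
have mul_neq0 M v : M \in unitmx -> v != 0 -> v *m M != 0.
  by move=> uM; apply: contraNneq => /(canRL (mulmxK uM)) ->; rewrite mul0mx.
(* In frame coordinates the map is [eta]; undoing both changes of frame gives eta(v A^-1) B = eta(v)
   eta(A^-1) B. *)
exists eta, (map_mx eta (invmx A) *m B); split.
  by rewrite unitmx_mul uB andbT map_unitmx unitmx_inv.
move=> v /SP[v0 [w w0 vw]]; rewrite vw mulmxA -map_mxM.
rewrite -[w](mulmxKV uB) -[LHS]mx_image_rho -[RHS]mx_image_rho.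
have [|g gE] := muE (v *m invmx A) (w *m invmx B).
  exact: AQB (congr1 (fun u => point u) (mulmxKV uA v)) vw.
have uA' : invmx A \in unitmx by rewrite unitmx_inv.
have yx := point_AEnd munu etaP (mul_neq0 _ _ uA' v0) (mul_neq0 _ _ uB' w0) gE.
exact: (congr1 (fun X => mx_image X (rho_mx B)) (esym yx)).
Qed.

(** * From one-dimensional subspaces to points of PG(1,F), and field automorphisms as
    projectivities *)

Lemma PG1_vline X : @PG1 F L X -> exists2 v, v != 0 & X = <[v]>%VS.
Proof.
rewrite /PG1 /= => dX; exists (vpick X).
  by rewrite vpick0 -dimv_eq0 dX.
apply/esym/eqP; rewrite eqEdim -memvE memv_pick dim_vline vpick0 -dimv_eq0 dX.
by [].
Qed.

Lemma Lset_iota (T : set 'rV[E]_2) : Lset T = @iotaPG F L @` Bset T.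
Proof.
apply/seteqP; split => [X TX | _ [X [_ TX] <-]]; last exact: TX.
have [[v v0 vX] _] := TX; exists <[v]>%VS; last by rewrite iotaPG_vline.
by split; [rewrite /PG1 /= dim_vline v0 | rewrite /= iotaPG_vline // vX].
Qed.

Lemma vlineZ c v : c != 0 -> <[c *: v]>%VS = <[v]>%VS.
Proof.
move=> c0; apply/eqP; rewrite eqEdim !dim_vline scaler_eq0 negb_or c0 leqnn andbT.
by apply/vlineP; exists c.
Qed.

Lemma iotaPG_inj X Y : @PG1 F L X -> PG1 Y -> iotaPG X = iotaPG Y -> X = Y.
Proof.
move=> /PG1_vline[v v0 ->] /PG1_vline[w w0 ->].
rewrite (iotaPG_vline v0) (iotaPG_vline w0) => /(point_eqP w0)[c c0 ->].
exact/esym/vlineZ.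
Qed.

(** As a unit [h] of E, [eta] satisfies h^-1 rho_b h = rho_(eta b) by multiplicativity; so the
    scalar matrix of [h] acts as [eta], up to a unit factor on generators. *)
Lemma GL2_AEnd (eta : 'AEnd(L)) :
  exists2 Q, GL2 Q & forall v, mx_image (point v) Q = point (map_mx eta v).
Proof.
pose h : E := eta; pose h' : E := (h^-1)%VF.
have ker0 : lker h == 0%VS by apply/(kAutf_lker0 (K := 1%AS))/k1AHom.
have hh' : h * h' = 1 by apply: lker0_compVf.
have h'h : h' * h = 1 by apply: lker0_compfV.
exists h%:M; first exact: GL2_scalar hh' h'h.
move=> v; rewrite mx_image_cyclic -(cyclic_submodZ _ hh'); congr cyclic_submod.
apply/rowP=> k; rewrite !rho_rowE -diag_const_mx mul_mx_diag !mxE.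
apply/lfunP=> x; rewrite !lfun_mulE !lfunE /=.
rewrite [LHS](rmorphM eta); congr (_ * _).
by rewrite -[LHS](lfun_mulE h' h) h'h id_lfunE.
Qed.

Lemma map_AEnd_neq0 (eta : 'AEnd(L)) v M : M \in unitmx -> v != 0 ->
  map_mx eta v *m M != 0.
Proof.
move=> uM; apply: contraNneq => /(canRL (mulmxK uM)); rewrite mul0mx.
move=> /rowP ev; apply/eqP/rowP=> k; have /eqP := ev k.
by rewrite !mxE fmorph_eq0 => /eqP.
Qed.

(** For t >= 2 the quotient (q^t - 1)/(q - 1) is at least q + 1, hence at least 3. *)
Lemma scattered_three (T : set 'rV[E]_2) : (2 <= \dim {:L})%N -> scattered T ->
  exists X Y Z, [/\ Lset T X, Lset T Y & Lset T Z] /\ [/\ X <> Y, X <> Z & Y <> Z].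
Proof.
move=> t2; rewrite /scattered; set n := (_ %/ _)%N.
have n3 : (3 <= n)%N.
  have q2 : (1 < #|F|)%N := finNzRing_gt1 F.
  rewrite /n leq_divRL ?subn_gt0 //.
  apply: (@leq_trans (#|F| ^ 2 - 1)).
    by rewrite (subn_sqr #|F| 1) mulnC leq_mul2l addn1 ltnS q2 orbT.
  by apply: leq_sub2r; rewrite leq_exp2l.
rewrite card_eq_sym => /card_set_bijP[f [fT f_inj _]].
have lt_n k : (k < 3)%N -> (k < n)%N by move=> k3; apply: leq_trans n3.
exists (f 0%N), (f 1%N), (f 2%N); split; first by split; apply/fT/lt_n.
have f_neq i j : (i < 3)%N -> (j < 3)%N -> i <> j -> f i <> f j.
  by move=> i3 j3 ij /f_inj; rewrite !inE => /(_ (lt_n _ i3) (lt_n _ j3)).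
by split; apply: f_neq.
Qed.

End LinearSets.

(** * Collineations from B(T) to B(U) against projectivities from L_T to L_U *)

Theorem theorem18 (F : finFieldType) (L : fieldExtType F)
    (ht : (2 <= \dim {:L})%N) (T U : set 'rV['End(L)]_2)
    (hT : PG1E T) (hU : PG1E U) (hTs : scattered T) :
  (exists kappa : {vspace 'rV[L]_2} -> {vspace 'rV[L]_2},
    (exists2 eta : 'End(L), kAut 1%VS {:L}%VS eta & collineation_with eta kappa)
    /\ kappa @` Bset T = Bset U)
  <->
  (exists pi : set 'rV['End(L)]_2 -> set 'rV['End(L)]_2,
    projectivity pi /\ pi @` Lset T = Lset U).
Proof.
split=> [[kappa [[eta0 /andP[eta_hom _] [M uM kappaE]] kappaT]]|].
  have [eta etaE] : exists eta : 'AEnd(L), ahval eta = eta0.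
    by rewrite k1HomE in eta_hom; exists (AHom eta_hom).
  rewrite -etaE in kappaE.
  (* The matrix [Q] applies [eta] and then [M], as [kappa] does. *)
  have [Q1 GQ1 Q1E] := GL2_AEnd eta.
  have [Q GQ QE] := mx_image_comp GQ1 (GL2_rho uM).
  exists (fun X => mx_image X Q); split; first exact: projectivity_mx_image.
  rewrite (Lset_iota T) (Lset_iota U) -kappaT !image_comp; apply: eq_imagel.
  move=> X [/PG1_vline[v v0 ->] _] /=.
  rewrite (kappaE v v0) (iotaPG_vline v0).
  rewrite (iotaPG_vline (map_AEnd_neq0 eta uM v0)) QE Q1E.
  exact: mx_image_rho.
move=> [pi [[P GP piE] piT]].
pose S := [set v : 'rV[L]_2 | v != 0 /\ Lset T (cyclic_submod (rho_row v))].
have piP v : v != 0 -> pi (cyclic_submod (rho_row v))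
    = mx_image (cyclic_submod (rho_row v)) P.
  by move=> v0; rewrite (piE _ (rho_admissible v0)) mx_image_cyclic.
have SU v : S v -> Lset U (mx_image (cyclic_submod (rho_row v)) P).
  by move=> [v0 vT]; rewrite -(piP v v0) -piT; exists (cyclic_submod (rho_row v)).
have [||eta [M [uM PE]]] :=
    @GL2_semilinear_on F L S P GP.
- move=> v Sv; split; first by case: Sv.
  by have [[w w0 <-] _] := SU v Sv; exists w.
- have [X [Y [Z [[XT YT ZT] XYZ]]]] := scattered_three ht hTs.
  have [[x x0 xX] _] := XT; have [[y y0 yY] _] := YT.
  have [[z z0 zZ] _] := ZT.
  by exists x, y, z; rewrite /S /= xX yY zZ.
(* The choice made by [vpick] is harmless: replacing [v] by c v multiplies the image vector by
   eta(c). *)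
pose kappa (X : {vspace 'rV[L]_2}) := <[map_mx eta (vpick X) *m M]>%VS.
have kappaE v : v != 0 -> kappa <[v]>%VS = <[map_mx eta v *m M]>%VS.
  move=> v0; have [c cE] := vlineP _ _ (memv_pick <[v]>%VS).
  have c0 : c != 0.
    apply: contraNneq v0 => c0; move: cE; rewrite c0 scale0r => /eqP.
    by rewrite vpick0 -memv0 => /eqP <-; apply: memv_line.
  rewrite /kappa cE map_mxZ -scalemxAl; apply: vlineZ.
  by rewrite fmorph_eq0.
(* Through [iotaPG], [kappa] agrees with [pi] on the points of L_T, which is all that the image of
   B(T) depends on. *)
have iota_kappa v : S v -> iotaPG (kappa <[v]>%VS) = pi (iotaPG <[v]>%VS).
  move=> Sv; have [v0 _] := Sv.
  rewrite (kappaE v v0) (iotaPG_vline v0) (piP v v0) (PE v Sv).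
  exact: iotaPG_vline (map_AEnd_neq0 eta uM v0).
exists kappa; split.
  exists eta; first by rewrite kAutfE k1AHom.
  by exists M.
have BS v : v != 0 -> Bset T <[v]>%VS -> S v.
  by move=> v0 [_ vT]; split; [exact: v0 | rewrite -(iotaPG_vline v0); exact: vT].
have kappa_PG1 v : v != 0 -> PG1 (kappa <[v]>%VS).
  by move=> v0; rewrite (kappaE v v0) /PG1 /= dim_vline (map_AEnd_neq0 eta uM v0).
apply/seteqP; split=> [_ [X XT <-] | Y [Y1 YU]].
  have [/PG1_vline[v v0 vX] vT] := XT; rewrite vX in XT vT *.
  split; first exact: kappa_PG1.
  by rewrite /preimage /= (iota_kappa v (BS v v0 XT)) -piT; exists (iotaPG <[v]>%VS).
have : Lset U (iotaPG Y) by exact: YU.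
rewrite -piT Lset_iota => -[_ [X XT <-]] XY; exists X; first exact: XT.
have [/PG1_vline[v v0 vX] _] := XT; rewrite vX in XT XY *.
(* Injectivity of [iotaPG] reduces the equality of subspaces to one of points of PG(1,F). *)
apply: iotaPG_inj (kappa_PG1 v v0) Y1 _.
exact: etrans (iota_kappa v (BS v v0 XT)) XY.
Qed.
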